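(* Let $p>2$, $1<\alpha<p-1$, $w_\alpha(x)=|x_1|^\alpha$ on $\mathbb R^d$ (so that $w_\alpha\in A_p(\mathbb R^d)$), and let $d\omega_\alpha=w_\alpha\,dx$ and $d\pi=d\omega_\alpha$. Then the scale-decay condition holds with $\delta=2$: with $\Phi_\pi(x,r)=r^2\pi(B(x,r))/\omega_\alpha(B(x,r))$ there is $C_0$ such that $$\Phi_\pi(x,r)\le C_0\Big(\frac rR\Big)^2\Phi_\pi(x,R),\qquad x\in\mathbb R^d,\ 0<r<R;$$ the controlled-enlargement condition holds: there is $C_M$ such that $$\pi(B(x,2r))\le C_M\Big[\pi(B(x,r))+\frac{\omega_\alpha(B(x,r))}{r^2}\Big],\qquad x\in\mathbb R^d,\ r>0;$$ but the quadratic mixed Poincaré inequality fails: there are no finite constants $C$ and $\Lambda\ge1$ such that $$\int_B\int_B|u(x)-u(y)|^2\,d\omega_\alpha(x)\,d\pi(y)\le Cr_B^2\pi(B)\int_{\Lambda B}|\nabla u|^2\,d\omega_\alpha$$ for every ball $B\subset\mathbb R^d$ (with radius $r_B$) and every locally Lipschitz function $u$ on $\mathbb R^d$.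
   Context: $x=(x_1,\dots,x_d)\in\mathbb R^d$, $d\ge1$; balls are open Euclidean balls and $\Lambda B$ is the concentric dilate. $A_p(\mathbb R^d)$ is the Muckenhoupt class. *)

(* Defs.v *)
From HB Require Import structures.
From mathcomp Require Import all_boot all_order all_algebra.
From mathcomp Require Import all_classical all_reals all_analysis measurable_realfun.
Set Implicit Arguments.
Unset Strict Implicit.
Unset Printing Implicit Defensive.
Import Order.TTheory GRing.Theory Num.Theory.
Import numFieldNormedType.Exports.
Local Open Scope classical_set_scope.
Local Open Scope ring_scope.

(* The sigma-algebra on R^n generated by the coordinates, which is the Borel
   sigma-algebra. *)
Definition rV_display : measure_display.
Proof. exact: default_measure_display. Qed.

Section measurable_rV.
Context (R : realType) (n : nat).

Definition rV_coord (i : 'I_n) (x : 'rV[R]_n) : measurableTypeR R := x ord0 i.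

Let rV_set0 : g_sigma_preimage rV_coord set0.
Proof. exact: sigma_algebra0. Qed.

Let rV_setC A : g_sigma_preimage rV_coord A -> g_sigma_preimage rV_coord (~` A).
Proof. exact: sigma_algebraC. Qed.

Let rV_bigcup (F : (set 'rV[R]_n)^nat) :
  (forall i, g_sigma_preimage rV_coord (F i)) ->
  g_sigma_preimage rV_coord (\bigcup_i F i).
Proof. exact: sigma_algebra_bigcup. Qed.

HB.instance Definition _ :=
  @isMeasurable.Build rV_display
    'rV[R]_n (g_sigma_preimage rV_coord) rV_set0 rV_setC rV_bigcup.

Lemma measurable_rV_coord (i : 'I_n) : measurable_fun [set: 'rV[R]_n] (rV_coord i).
Proof.
move=> _ Y mY; rewrite setTI; apply: sub_sigma_algebra => /=.
rewrite -bigcup_seq/=; exists i => /=; first by rewrite mem_index_enum.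
by exists Y => //; rewrite setTI.
Qed.

End measurable_rV.

Lemma measurable_fun_rVP (R : realType) n d (T : measurableType d) (f : T -> 'rV[R]_n) :
  measurable_fun setT f <->
  forall i, measurable_fun setT (rV_coord i \o f).
Proof.
split=> [mf i|mf].
  by apply: measurableT_comp => //; exact: measurable_rV_coord.
have prefS : g_sigma_preimage (fun i => rV_coord i \o f) `<=` measurable.
  apply: smallest_sub; first exact: sigma_algebra_measurable.
  case: n => [|m] in f mf *; first by rewrite big_ord0.
  rewrite -bigcup_mkord_ord; apply: bigcup_sub => i Ii.
  by move=> A [B mB <-]; exact: mf.
rewrite g_sigma_preimage_comp in prefS.
by move=> _ A mA; apply: prefS; exists A.
Qed.

Section lebesgue_rV.
Context (R : realType).
Local Open Scope ereal_scope.

Section cons.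
Context (n : nat).

Definition rV_cons (p : measurableTypeR R * 'rV[R]_n) : 'rV[R]_n.+1 :=
  row_mx (p.1 : R)%:M p.2.

Definition rV_uncons (x : 'rV[R]_n.+1) : measurableTypeR R * 'rV[R]_n :=
  (x ord0 ord0, @rsubmx R 1 1 n x).

Lemma rV_consK : cancel rV_cons rV_uncons.
Proof.
move=> [a x]; rewrite /rV_cons /rV_uncons /= row_mxKr; congr pair.
have -> : (ord0 : 'I_n.+1) = lshift n (ord0 : 'I_1) by apply/val_inj.
by rewrite (@row_mxEl R 1 1 n) mxE.
Qed.

Lemma measurable_rV_cons : measurable_fun setT rV_cons.
Proof.
apply/measurable_fun_rVP => i; rewrite /rV_coord /=.
case: (@splitP 1 n i) => j ij.
  have -> : i = @lshift 1 n j by apply/val_inj.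
  rewrite (_ : _ \o _ = fst) //; apply/funext => -[a x] /=.
  by rewrite (@row_mxEl R 1 1 n) mxE (ord1 j).
have -> : i = @rshift 1 n j by apply/val_inj.
rewrite (_ : _ \o _ = rV_coord j \o snd).
  by apply: measurableT_comp => //; exact: measurable_rV_coord.
by apply/funext => -[a x] /=; rewrite (@row_mxEr R 1 1 n).
Qed.

Lemma measurable_rV_uncons : measurable_fun setT rV_uncons.
Proof.
apply/measurable_fun_pairP; split; first exact: measurable_rV_coord.
apply/measurable_fun_rVP => i.
rewrite (_ : _ \o _ = rV_coord (@rshift 1 n i)); first exact: measurable_rV_coord.
by apply/funext => x; rewrite /rV_coord /= mxE.
Qed.

End cons.

Section step.
Context (n : nat) (mu : {sigma_finite_measure set 'rV[R]_n -> \bar R}).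

Definition lebesgue_rV_step : set 'rV[R]_n.+1 -> \bar R :=
  pushforward (lebesgue_measure \x mu) (@rV_cons n).

Let step0 : lebesgue_rV_step set0 = 0.
Proof. by rewrite /lebesgue_rV_step /pushforward preimage_set0 measure0. Qed.

Let step_ge0 A : 0 <= lebesgue_rV_step A.
Proof. by rewrite /lebesgue_rV_step /pushforward measure_ge0. Qed.

Let mcons A : measurable A -> measurable (@rV_cons n @^-1` A).
Proof. by move=> mA; rewrite -[X in measurable X]setTI; exact: measurable_rV_cons. Qed.

Let step_sigma_additive : semi_sigma_additive lebesgue_rV_step.
Proof.
move=> F mF tF mUF; rewrite /lebesgue_rV_step /pushforward preimage_bigcup.
apply: measure_semi_sigma_additive.
- by move=> k; exact: mcons.
- apply/trivIsetP => /= i j _ _ ij; rewrite -preimage_setI.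
  by move/trivIsetP : tF => /(_ _ _ _ _ ij) ->//; rewrite preimage_set0.
- by rewrite -preimage_bigcup; exact: mcons.
Qed.

HB.instance Definition _ := isMeasure.Build _ _ _ lebesgue_rV_step
  step0 step_ge0 step_sigma_additive.

Let step_sigma_finite : sigma_finite setT lebesgue_rV_step.
Proof.
have /sigma_finiteP[F [TF ndF Foo]] := sigma_finiteT (@lebesgue_measure R).
have /sigma_finiteP[G [TG ndG Goo]] := sigma_finiteT mu.
exists (fun k => @rV_uncons n @^-1` (F k `*` G k)).
  rewrite -preimage_bigcup -[LHS](preimage_setT (@rV_uncons n)); congr (_ @^-1` _).
  rewrite -setXTT TF TG predeqE => -[x y]; split.
    move=> [/= [i _ Fix] [k _ Gky]]; exists (maxn i k) => //; split.
    - by move: x Fix; exact/subsetPset/ndF/leq_maxl.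
    - by move: y Gky; exact/subsetPset/ndG/leq_maxr.
  by move=> [i _ []/= ? ?]; split; exists i.
move=> k; have [? ?] := Foo k; have [? ?] := Goo k; split.
  rewrite -[X in measurable X]setTI; apply: measurable_rV_uncons => //.
  exact: measurableX.
rewrite /lebesgue_rV_step /pushforward (_ : _ @^-1` _ = F k `*` G k); last first.
  by apply/funext => q; rewrite /preimage /mkset rV_consK.
by rewrite product_measure1E// lte_mul_pinfty// ge0_fin_numE.
Qed.

HB.instance Definition _ := Measure_isSigmaFinite.Build _ _ _ lebesgue_rV_step
  step_sigma_finite.

End step.

(* Lebesgue measure on R^n, as the n-fold product of one-dimensional Lebesgue
   measure; on the one-point space R^0 it is the unit mass. *)
Fixpoint lebesgue_rV (n : nat) : {sigma_finite_measure set 'rV[R]_n -> \bar R} :=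
  match n with
  | 0%N => dirac (0%R : 'rV[R]_0)
  | n'.+1 => lebesgue_rV_step (lebesgue_rV n')
  end.

End lebesgue_rV.

Section euclidean.
Context (R : realType) (n : nat).

(* The norm that the library puts on row vectors is the maximum norm. *)
Definition enorm (x : 'rV[R]_n) : R := Num.sqrt (\sum_(i < n) x ord0 i ^+ 2).

Definition eball (x : 'rV[R]_n) (r : R) : set 'rV[R]_n :=
  [set y | enorm (y - x) < r].

(* By Rademacher's theorem a locally Lipschitz function has partial derivatives
   outside a Lebesgue-null set; on that set 'D_ takes an arbitrary value. *)
Definition gradient (u : 'rV[R]_n -> R) (x : 'rV[R]_n) : 'rV[R]_n :=
  \row_i 'D_(delta_mx ord0 i) u x.

End euclidean.

Section muckenhoupt.
Context (R : realType) (n : nat).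
Local Open Scope ereal_scope.

Definition average (A : set 'rV[R]_n) (f : 'rV[R]_n -> R) : \bar R :=
  (\int[lebesgue_rV R n]_(x in A) (f x)%:E) / lebesgue_rV R n A.

(* The A_p class. As 0 `^ r = 0 for r < 0, the second average is the usual one
   only because w > 0 almost everywhere. *)
Definition muckenhoupt (p : R) (w : 'rV[R]_n -> R) : Prop :=
  [/\ measurable_fun setT (w : _ -> measurableTypeR R),
      (forall x, (0 <= w x)%R),
      {ae lebesgue_rV R n, forall x, (0 < w x)%R},
      (forall x r, (lebesgue_rV R n).-integrable (eball x r) (EFin \o w))
    & exists K : R, forall (x : 'rV[R]_n) (r : R), (0 < r)%R ->
        average (eball x r) w *
        average (eball x r) (fun y => w y `^ (- (p - 1)^-1))%R `^ (p - 1)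
        <= K%:E].

End muckenhoupt.

Section power_weight.
Context (R : realType) (d : nat) (alpha : R).
Local Open Scope ereal_scope.

Definition power_weight (x : 'rV[R]_d.+1) : R := (`|x ord0 ord0| `^ alpha)%R.

Definition power_measure (A : set 'rV[R]_d.+1) : \bar R :=
  \int[lebesgue_rV R d.+1]_(x in A) (power_weight x)%:E.

Lemma measurable_power_weight :
  measurable_fun setT (power_weight : _ -> measurableTypeR R).
Proof.
apply: (@measurableT_comp _ _ _ _ _ _ (@powR R ^~ alpha)) => //.
apply: (@measurableT_comp _ _ _ _ _ _ (@Num.norm R R)) => //.
exact: measurable_rV_coord.
Qed.

Let power_measure0 : power_measure set0 = 0.
Proof. exact: integral_set0. Qed.

Let power_measure_ge0 A : 0 <= power_measure A.
Proof. by apply: integral_ge0 => x _; rewrite lee_fin powR_ge0. Qed.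

Let power_measure_sigma_additive : semi_sigma_additive power_measure.
Proof.
apply: semi_sigma_additive_nng_induced.
  by apply/measurable_EFinP; exact: measurable_power_weight.
by move=> x; rewrite lee_fin powR_ge0.
Qed.

HB.instance Definition _ := isMeasure.Build _ _ _ power_measure
  power_measure0 power_measure_ge0 power_measure_sigma_additive.

End power_weight.

Section conditions.
Context (R : realType) (n : nat).
Variables om pi : {measure set 'rV[R]_n -> \bar R}.
Local Open Scope ereal_scope.

Definition Phi (x : 'rV[R]_n) (r : R) : \bar R :=
  (r ^+ 2)%:E * pi (eball x r) / om (eball x r).

Definition scale_decay (delta : R) : Prop :=
  exists C0 : R, forall (x : 'rV[R]_n) (r s : R), (0 < r < s)%R ->
    Phi x r <= (C0 * (r / s) `^ delta)%:E * Phi x s.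

Definition controlled_enlargement : Prop :=
  exists CM : R, forall (x : 'rV[R]_n) (r : R), (0 < r)%R ->
    pi (eball x (2 * r)) <=
    CM%:E * (pi (eball x r) + om (eball x r) / (r ^+ 2)%:E).

(* The library's local Lipschitz condition refers to the maximum norm on row
   vectors, which changes the Lipschitz constants but not the class of u. *)
Definition mixed_poincare : Prop :=
  exists C Lambda : R, (1 <= Lambda)%R /\
    forall (z : 'rV[R]_n) (r : R) (u : 'rV[R]_n -> R), (0 < r)%R ->
    [locally [lipschitz u x | x in setT]] ->
    \int[pi]_(y in eball z r) \int[om]_(x in eball z r)
      (`|u x - u y| ^+ 2)%:E
    <= (C * r ^+ 2)%:E * pi (eball z r) *
       \int[om]_(x in eball z (Lambda * r)) (enorm (gradient u x) ^+ 2)%:E.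

End conditions.

(* Main.v *)
Require Import Defs.
From mathcomp Require Import all_boot all_order all_algebra.
From mathcomp Require Import all_classical all_reals all_analysis.
From mathcomp Require Import measurable_realfun ring lra.
Import Order.TTheory GRing.Theory Num.Theory.
Import numFieldNormedType.Exports.
Local Open Scope classical_set_scope.
Local Open Scope ring_scope.

Set Implicit Arguments.
Unset Strict Implicit.
Unset Printing Implicit Defensive.

(* The condition pi = omega reduces Phi(x, r) to r^2 and the enlargement
   condition to doubling. Both doubling and the A_p bound follow by comparing
   balls with cubes, on which Fubini reduces the averages of |x_1|^g to
   one-dimensional ones: they are of order (|x_1| + r)^alpha for g = alpha,
   and of order (|x_1| + r)^g also for g = - alpha / (p - 1), because
   alpha / (p - 1) < 1 makes |t|^g integrable at 0.
   The Poincare inequality fails because for alpha > 1 the hyperplane {x_1 = 0}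
   has zero quadratic capacity with respect to omega: the functions
   u(x) = ramp_e(x_1), which vary from 0 to 1 on the slab 0 < x_1 < e, have energy
   O(e^-2 * e^alpha * e) = O(e^(alpha - 1)) on every ball, while the left-hand
   side is bounded below by the masses of two fixed cubes on either side. *)

(** * Monotonicity and lower bounds for integrals of nonnegative functions *)

Section integral_lemmas.
Context d (T : measurableType d) (R : realType) (mu : {measure set T -> \bar R}).
Local Open Scope ereal_scope.

(** The integral of a nonnegative function is a supremum over the simple functions below it, and
    this supremum is monotone for arbitrary functions. Hence no measurability of gradients or of
    inner integrals has to be checked. *)
Lemma ge0_le_integral_nomeas (D : set T) (f g : T -> \bar R) :
  (forall x, D x -> 0 <= f x) -> (forall x, D x -> f x <= g x) ->
  \int[mu]_(x in D) f x <= \int[mu]_(x in D) g x.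
Proof.
move=> f0 fg; have g0 x : D x -> 0 <= g x.
  by move=> Dx; exact: le_trans (f0 _ Dx) (fg _ Dx).
rewrite !ge0_integralE//; apply: le_ereal_sup => _ [h /= hf <-]; exists h => // x.
apply: le_trans (hf x) _; rewrite !patchE; case: ifPn => // /set_mem; exact: fg.
Qed.

(** Comparison with the simple function [c * \1_E]; [f] itself may be non-measurable. *)
Lemma integral_ge_cst (D E : set T) (f : T -> \bar R) (c : R) :
  measurable D -> measurable E -> E `<=` D ->
  (0 <= c)%R -> (forall x, D x -> 0 <= f x) -> (forall x, E x -> c%:E <= f x) ->
  c%:E * mu E <= \int[mu]_(x in D) f x.
Proof.
move=> mD mE ED c0 f0 cf.
apply: (@le_trans _ _ (\int[mu]_(x in D) (c * \1_E x)%:E)).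
  under eq_integral do rewrite EFinM.
  rewrite ge0_integralZl//; first by rewrite integral_indic// setIidl.
  by apply/measurable_EFinP; exact: measurable_indic.
apply: ge0_le_integral_nomeas => x Dx; first by rewrite lee_fin mulr_ge0.
rewrite indicE; have [/set_mem/cf|_] := boolP (x \in E); first by rewrite mulr1.
by rewrite mulr0 f0.
Qed.

End integral_lemmas.

(** * Integrability of negative powers at the origin *)

Section power_integral.
Context {R : realType}.
Local Open Scope ereal_scope.
Notation mu := (@lebesgue_measure R).

(** The singularity is avoided by exhausting the interval with compact ones, applying the
    fundamental theorem of calculus to the primitive [F] on each, and passing to the limit by
    monotone convergence. *)
Lemma integral_powR_lt (b c : R) : (0 < b < 1)%R -> (0 < c)%R ->
  \int[mu]_(t in `]0%R, c]) (t `^ (- b))%:E <= ((1 - b)^-1 * c `^ (1 - b))%:E.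
Proof.
(* The shift to [n.+2] gives [e n < c] already for [n = 0], so every interval is nondegenerate. *)
move=> /andP[b0 b1] c0; pose e n := (c / n.+2%:R)%R.
have e0 n : (0 < e n)%R by rewrite divr_gt0.
have ec n : (e n < c)%R by rewrite ltr_pdivrMr// ltr_pMr// ltr1n.
have -> : `]0%R, c]%classic = \bigcup_n `[e n, c]%classic.
  apply/seteqP; split=> t /=.
    rewrite in_itv/= => /andP[t0 tc].
    have [n _ nt] := near_infty_natSinv_lt (PosNum (divr_gt0 t0 c0)).
    exists n => //=; rewrite in_itv/= tc andbT /e.
    have := nt _ (leqnSn n); rewrite /= ltr_pdivlMr// => /ltW.
    by rewrite mulrC.
  by move=> [n _]; rewrite /= !in_itv/= => /andP[/(lt_le_trans (e0 n))-> ->].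
pose F t : R := ((1 - b)^-1 * t `^ (1 - b))%R.
have mf D : measurable_fun D (fun t : R => (t `^ (- b))%:E).
  apply/measurable_EFinP; apply: measurable_funTS; exact: measurable_powR.
have eS n m : (n <= m)%N -> (e m <= e n)%R.
  by move=> nm; rewrite ler_pM2l// lef_pV2 ?posrE// ler_nat.
have ndI : nondecreasing_seq (fun n => `[e n, c]%classic).
  move=> n m nm; apply/subsetPset => t /=; rewrite !in_itv/= => /andP[et ->].
  by rewrite (le_trans (eS _ _ nm) et).
have cvgI := @ge0_nondecreasing_set_cvg_integral _ (measurableTypeR R) R
  (fun n => `[e n, c]%classic) (fun t => (t `^ (- b))%:E) mu ndI
  (fun n => measurable_itv _) (fun n => mf _) (fun n t _ => powR_ge0 _ _).
move/cvg_lim: (cvgI) => <- //.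
apply: lime_le; first by apply/cvg_ex; eexists; exact: cvgI.
apply: nearW => n.
have dF (t : R) : (0 < t)%R -> is_derive t 1%R F (t `^ (- b))%R.
  move=> t0; rewrite /F; have h := is_derive1_powR (1 - b) t0.
  apply: is_derive_eq; rewrite /= [X in powR _ X](_ : _ = - b)%R; last by lra.
  by rewrite [_ *: _]mulrA mulVf ?mul1r// subr_eq0 gt_eqF.
have cF (t : R) : (0 < t)%R -> {for t, continuous F}.
  move=> t0; apply: differentiable_continuous; apply/derivable1_diffP.
  by case: (dF _ t0).
have cf (t : R) : (0 < t)%R -> {for t, continuous (fun t : R => t `^ (- b))%R}.
  move=> t0; apply: differentiable_continuous; apply/derivable1_diffP.
  by apply: derivable_powR; rewrite in_itv/= t0.
have itv0 t : t \in `]e n, c[%R -> (0 < t)%R.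
  by rewrite in_itv/= => /andP[/(lt_trans (e0 n))].
rewrite (@continuous_FTC2 _ _ F)//.
- rewrite -EFinB lee_fin /F lerBlDr lerDl mulr_ge0 ?powR_ge0//.
  by rewrite invr_ge0 subr_ge0 ltW.
- apply: continuous_in_subspaceT => t /set_mem /=; rewrite in_itv/= => /andP[et _].
  exact/cf/(lt_le_trans (e0 n)).
- split.
  + by move=> t /itv0 t0; case: (dF _ t0).
  + exact/cvg_at_right_filter/cF.
  + exact/cvg_at_left_filter/cF.
- by move=> t /itv0 t0; rewrite derive1E; case: (dF _ t0).
Qed.

Lemma integral_norm_powR_lt (b c : R) : (0 < b < 1)%R -> (0 < c)%R ->
  \int[mu]_(t in `](- c)%R, c[) (`|t| `^ (- b))%:E <=
    (2 * (1 - b)^-1 * c `^ (1 - b))%:E.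
Proof.
move=> b01 c0.
have mf : measurable_fun setT (fun t : R => (`|t| `^ (- b))%:E).
  by apply/measurable_EFinP; apply: (measurableT_comp (measurable_powR _)).
have f0 (t : R) : 0 <= (`|t| `^ (- b))%:E by rewrite lee_fin powR_ge0.
have pos : \int[mu]_(t in `]0%R, c]) (`|t| `^ (- b))%:E <=
    ((1 - b)^-1 * c `^ (1 - b))%:E.
  apply: (le_trans _ (integral_powR_lt b01 c0)).
  under eq_integral => t /set_mem/= /[!in_itv]/= /andP[t0 _] do
    rewrite gtr0_norm//.
  by [].
(* Lebesgue measure is its own pushforward under negation, and the integrand is even. *)
have neg : \int[mu]_(t in `[(- c)%R, 0%R[) (`|t| `^ (- b))%:E =
    \int[mu]_(t in `]0%R, c]) (`|t| `^ (- b))%:E.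
  transitivity (\int[pushforward mu (-%R : R -> measurableTypeR R)]_(t in `]0%R, c])
      (`|t| `^ (- b))%:E); last first.
    by apply: eq_measure_integral => //= A mA _; exact: lebesgue_measureN.
  rewrite ge0_integral_pushforward; last 4 first.
  - exact: oppr_measurable.
  - exact: measurable_itv.
  - exact: measurable_funTS.
  - by move=> t _; exact: f0.
  rewrite opp_preimage_itvbndbnd/= oppr0.
  by apply: eq_integral => t _ /=; rewrite normrN.
have sub : `](- c)%R, c[%classic `<=`
    `[(-c)%R, 0%R[%classic `|` (`]0%R, c]%classic `|` [set 0%R]).
  move=> t /=; rewrite !in_itv/= => /andP[ct tc].
  have [t0|t0|->] := ltgtP t 0%R; [left|right;left|right;right] => //.
    by rewrite ltW.
  by rewrite ltW.
have mf' (D : set (measurableTypeR R)) :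
    measurable_fun D (fun t : R => (`|t| `^ (- b))%:E).
  exact: measurable_funTS.
have h : \int[mu]_(t in `](- c)%R, c[) (`|t| `^ (- b))%:E <=
    \int[mu]_(t in `[(-c)%R, 0%R[%classic `|` (`]0%R, c]%classic `|` [set 0%R]))
      (`|t| `^ (- b))%:E.
  by apply: ge0_subset_integral => //; do ?apply: measurableU.
apply: (le_trans h) => {h}.
rewrite ge0_integral_setU//; last 2 first.
- exact: measurableU.
- apply/disj_setPS => t /= []; rewrite !in_itv/= => /andP[_ t0] [/andP[]|]; lra.
rewrite ge0_integral_setU//; last first.
  by apply/disj_setPS => t /= []; rewrite !in_itv/= => /andP[+ _] t0; rewrite t0 ltxx.
by rewrite integral_set1// adde0 neg -mulrA mulr_natl mulr2n EFinD leeD.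
Qed.
End power_integral.

(** * Integrals of powers over arbitrary intervals *)

Section power_bounds.
Context {R : realType}.
Local Open Scope ereal_scope.
Notation mu := (@lebesgue_measure R).

Lemma lebesgue_measure_itvoo (a b : R) : (a <= b)%R ->
  mu `]a, b[ = (b - a)%:E.
Proof.
move=> ab; rewrite lebesgue_measure_itv/= lte_fin; case: ltP => //.
by move=> ba; rewrite (@le_anti _ _ a b) ?ab// subrr.
Qed.

Lemma measurable_norm_powR (g : R) (D : set (measurableTypeR R)) :
  measurable_fun D (fun t : R => (`|t| `^ g)%:E).
Proof.
apply: measurable_funTS; apply/measurable_EFinP.
exact: (measurableT_comp (measurable_powR _)).
Qed.

Lemma integral_le_cst (f : R -> R) (D : set (measurableTypeR R)) (M : R) :
  measurable D -> measurable_fun D (EFin \o f) ->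
  (forall t, D t -> (0 <= f t <= M)%R) ->
  \int[mu]_(t in D) (f t)%:E <= M%:E * mu D.
Proof.
move=> mD mf fM; rewrite -integral_cst//; apply: ge0_le_integral => //.
- by move=> t /fM/andP[]; rewrite lee_fin.
- by move=> t /fM/andP[]; rewrite lee_fin.
Qed.

Lemma norm_itv (a r t : R) :
  t \in `](a - r)%R, (a + r)%R[ -> (`|a| - r <= `|t| <= `|a| + r)%R.
Proof.
rewrite in_itv/= -ltr_distlC => h; apply/andP; split.
  by rewrite lerBlDr -lerBlDl (le_trans (lerB_dist _ _))// ltW.
by rewrite -lerBlDl (le_trans (lerB_dist _ _))// distrC ltW.
Qed.

Lemma integral_norm_powR_ge0 (a r g : R) : (0 <= g)%R -> (0 < r)%R ->
  \int[mu]_(t in `](a - r)%R, (a + r)%R[) (`|t| `^ g)%:E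
    <= (2 * r * (`|a| + r) `^ g)%:E.
Proof.
move=> g0 r0.
have -> : (2 * r * (`|a| + r) `^ g)%:E =
    ((`|a| + r) `^ g)%:E * mu `](a - r)%R, (a + r)%R[.
  by rewrite lebesgue_measure_itvoo; [rewrite -EFinM; congr EFin; ring|lra].
apply: integral_le_cst => //; first exact: measurable_norm_powR.
move=> t /norm_itv/andP[_ h]; rewrite powR_ge0/=.
by apply: ge0_ler_powR => //; rewrite nnegrE// addr_ge0// ltW.
Qed.

(** Far from the origin ([2 * r <= |a|]) the integrand is comparable to a constant. Otherwise the
    interval is enlarged to the symmetric one of radius [|a| + r < 3 * r]. The factor [3 / (1 - b)]
    serves both cases. *)
Lemma integral_norm_powR_lt0 (a r b : R) : (0 < b < 1)%R -> (0 < r)%R ->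
  \int[mu]_(t in `](a - r)%R, (a + r)%R[) (`|t| `^ (- b))%:E
    <= (2 * r * (3 / (1 - b) * (`|a| + r) `^ (- b)))%:E.
Proof.
move=> b01 r0; have /andP[b0 b1] := b01.
have c0 : (0 < `|a| + r)%R by rewrite ltr_wpDl.
have [ra|ar] := leP (2 * r)%R `|a|%R.
  set M := (_ * (`|a| + r) `^ _)%R.
  have -> : (2 * r * M)%:E = M%:E * mu `](a - r)%R, (a + r)%R[.
    by rewrite lebesgue_measure_itvoo; [rewrite -EFinM; congr EFin; ring|lra].
  apply: integral_le_cst => //; first exact: measurable_norm_powR.
  move=> t /norm_itv/andP[h _]; rewrite powR_ge0/=.
  have tM : ((`|a| + r) / 3 <= `|t|)%R by lra.
  rewrite /M !powRN.
  have -> : (3 / (1 - b) * ((`|a| + r) `^ b)^-1 =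
    (1 - b)^-1 * (3 / ((`|a| + r) `^ b)))%R by ring.
  apply: (@le_trans _ _ (3 / (`|a| + r) `^ b)%R).
    rewrite -lef_pV2 ?posrE ?invr_gt0 ?divr_gt0 ?powR_gt0//; last by lra.
    rewrite invrK invf_div; apply: (@le_trans _ _ (((`|a| + r) / 3) `^ b)%R).
      rewrite (powRM _ (ltW c0))// ler_wpM2l ?powR_ge0//.
      by apply: ger1_powR; [lra|exact: ltW].
    by apply: ge0_ler_powR; rewrite ?nnegrE ?divr_ge0// ltW.
  by rewrite ler_peMl ?divr_ge0 ?powR_ge0// invf_ge1; lra.
apply: (@le_trans _ _
  (\int[mu]_(t in `](- (`|a| + r))%R, (`|a| + r)%R[) (`|t| `^ (- b))%:E)).
  apply: ge0_subset_integral => //; first exact: measurable_norm_powR.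
  move=> t /=; rewrite !in_itv/= => /andP[h1 h2].
  by have := ler_norm a; have := ler_norm (- a)%R; rewrite normrN; lra.
apply: (le_trans (integral_norm_powR_lt b01 c0)); rewrite lee_fin.
rewrite powRD ?powRr1 ?(ltW c0)//; last by rewrite (gt_eqF c0) implybT.
(* The difference of the two sides factors, with the sign of [2 * r - |a|]. *)
rewrite -subr_ge0.
have -> : (2 * r * (3 / (1 - b) * (`|a| + r) `^ (- b)) -
    2 / (1 - b) * ((`|a| + r) * (`|a| + r) `^ (- b)) =
  2 / (1 - b) * (`|a| + r) `^ (- b) * (2 * r - `|a|))%R by ring.
by rewrite !mulr_ge0 ?powR_ge0 ?invr_ge0//; lra.
Qed.

End power_bounds.

(** * Product sets, cubes and Fubini in the first coordinate *)

Section slabs.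
Context {R : realType}.
Local Open Scope ereal_scope.
Notation mu := (@lebesgue_measure R).

Definition slab n (I : set (measurableTypeR R)) (Q : set 'rV[R]_n) : set 'rV[R]_n.+1 :=
  @rV_uncons R n @^-1` (I `*` Q).

(** The open ball of the maximum norm, written coordinatewise so that the first coordinate splits
    off in [box_slab]. *)
Definition box n (c : 'rV[R]_n) (r : R) : set 'rV[R]_n :=
  [set y | forall i, (`|y ord0 i - c ord0 i| < r)%R].

Lemma measurable_slab n I (Q : set 'rV[R]_n) :
  measurable I -> measurable Q -> measurable (slab I Q).
Proof.
move=> mI mQ; rewrite -[slab I Q]setTI; apply: measurable_rV_uncons => //.
exact: measurableX.
Qed.

Lemma measurable_box n (c : 'rV[R]_n) r : measurable (box c r).
Proof.
have -> : box c r = \bigcap_(i in [set: 'I_n])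
    (rV_coord i @^-1` `](c ord0 i - r)%R, (c ord0 i + r)%R[).
  apply/seteqP; split=> y /=.
    by move=> h i _ /=; rewrite in_itv/= -ltr_distlC distrC; exact: h.
  by move=> h i; have := h i I; rewrite /= in_itv/= -ltr_distlC distrC.
apply: fin_bigcap_measurable => // i _.
by rewrite -[X in measurable X]setTI; apply: measurable_rV_coord.
Qed.

Lemma measurable_fun_ord0 n (g : R -> \bar R) (D : set 'rV[R]_n.+1) :
  measurable_fun [set: measurableTypeR R] g ->
  measurable_fun D (fun x : 'rV[R]_n.+1 => g (x ord0 ord0)).
Proof.
move=> mg; apply: measurable_funTS.
apply: (@measurableT_comp _ _ _ _ _ _ g _ (@rV_coord R n.+1 ord0) mg).
exact: measurable_rV_coord.
Qed.

(** Tonelli: Lebesgue measure in dimension [n.+1] is by construction a pushforward of a product, and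
    the integrand restricted to the slab separates into a factor in [t] and the indicator of [Q]. *)
Lemma integral_slab n I (Q : set 'rV[R]_n) (g : R -> \bar R) :
  measurable I -> measurable Q ->
  measurable_fun [set: measurableTypeR R] g -> (forall t, 0 <= g t) ->
  \int[lebesgue_rV R n.+1]_(x in slab I Q) g (x ord0 ord0) =
  (\int[mu]_(t in I) g t) * lebesgue_rV R n Q.
Proof.
move=> mI mQ mg g0.
transitivity (\int[pushforward (mu \x lebesgue_rV R n) (@rV_cons R n)]_(x in slab I Q)
    g (x ord0 ord0)); first by [].
rewrite ge0_integral_pushforward; last 4 first.
- exact: measurable_rV_cons.
- exact: measurable_slab.
- exact: measurable_fun_ord0.
- by move=> *; exact: g0.
have -> : @rV_cons R n @^-1` slab I Q = I `*` Q.
  by apply/funext => z; rewrite /slab /preimage /mkset rV_consK.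
rewrite integral_mkcond.
pose h (z : measurableTypeR R * 'rV[R]_n) := (g \_ I) z.1 * (\1_Q z.2)%:E.
have mgI : measurable_fun [set: measurableTypeR R] (g \_ I).
  by apply/(measurable_restrictT _ _).1 => //; exact: measurable_funTS.
have mQ2 : measurable_fun setT (fun z : measurableTypeR R * 'rV[R]_n => (\1_Q z.2) : R).
  by have h1 := @measurable_indic _ _ R setT Q mQ; apply: (measurableT_comp h1).
have gI0 t : 0 <= (g \_ I) t by apply: erestrict_ge0.
transitivity (\int[mu \x lebesgue_rV R n]_z h z).
  apply: eq_integral => -[t y] _; rewrite /h/= !patchE /= indicE in_setX /=.
  have -> : rV_cons (t, y) ord0 ord0 = t by have := congr1 fst (rV_consK (t, y)).
  by case: (t \in I); case: (y \in Q); rewrite /= ?mule1 ?mule0.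
rewrite fubini_tonelli1; last 2 first.
- apply: emeasurable_funM; first exact: (measurableT_comp mgI).
  exact/measurable_EFinP.
- by move=> z; rewrite mule_ge0// lee_fin.
rewrite /fubini_F /h /=.
transitivity (\int[mu]_t ((g \_ I) t * lebesgue_rV R n Q)).
  apply: eq_integral => t _; rewrite ge0_integralZl//.
    by rewrite integral_indic// setIT.
  by apply/measurable_EFinP; exact: measurable_indic.
by rewrite ge0_integralZr// -integral_mkcond.
Qed.

Lemma lebesgue_slab n I (Q : set 'rV[R]_n) : measurable I -> measurable Q ->
  lebesgue_rV R n.+1 (slab I Q) = mu I * lebesgue_rV R n Q.
Proof.
move=> mI mQ; rewrite -[LHS]mul1e -integral_cst; last exact: measurable_slab.
by rewrite (@integral_slab _ _ _ (cst 1))// integral_cst// mul1e.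
Qed.

Lemma lebesgue_hyperplane n (c : R) :
  lebesgue_rV R n.+1 (slab [set c] [set: 'rV[R]_n]) = 0.
Proof. by rewrite lebesgue_slab// lebesgue_measure_set1 mul0e. Qed.

Lemma box_slab n (c : 'rV[R]_n.+1) (r : R) :
  box c r = slab `](c ord0 ord0 - r)%R, (c ord0 ord0 + r)%R[
    (box (@rsubmx R 1 1 n c) r).
Proof.
apply/seteqP; split=> y; rewrite /slab /box /=.
  move=> h; split; first by rewrite in_itv/= -ltr_distlC distrC; exact: h.
  by move=> i; rewrite !mxE; exact: h.
move=> [h0 h] i; case: (@splitP 1 n i) => j ij.
  have -> : i = ord0 by apply/val_inj; rewrite /= ij (ord1 j).
  by rewrite distrC ltr_distlC; move: h0; rewrite in_itv.
have -> : i = @rshift 1 n j by apply/val_inj.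
by have := h j; rewrite !mxE.
Qed.

Lemma lebesgue_box n (c : 'rV[R]_n) (r : R) : (0 < r)%R ->
  lebesgue_rV R n (box c r) = ((2 * r) ^+ n)%:E.
Proof.
move=> r0; elim: n c => [c|n IH c].
  (* In dimension 0 the condition defining the cube is vacuous, and the unit mass is the empty
     power. *)
  by rewrite /= diracE mem_set ?expr0// => -[].
rewrite box_slab lebesgue_slab//; last exact: measurable_box.
rewrite IH.
rewrite lebesgue_measure_itvoo; last by lra.
by rewrite -EFinM exprS; congr (_ * _)%:E; ring.
Qed.

End slabs.

(** * Euclidean balls compared with cubes *)

Section balls.
Context {R : realType}.

Lemma enorm_ge0 n (z : 'rV[R]_n) : 0 <= enorm z.
Proof. exact: sqrtr_ge0. Qed.

Lemma coord_le_enorm n (z : 'rV[R]_n) i : `|z ord0 i| <= enorm z.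
Proof.
rewrite -sqrtr_sqr ler_wsqrtr// (bigD1 i)//= lerDl.
by apply: sumr_ge0 => j _; exact: sqr_ge0.
Qed.

Lemma enorm_lt n (z : 'rV[R]_n) (r : R) : 0 < r ->
  (enorm z < r) = (\sum_(i < n) z ord0 i ^+ 2 < r ^+ 2).
Proof.
move=> r0; rewrite -ltr_sqr ?nnegrE ?enorm_ge0 ?ltW// sqr_sqrtr//.
by apply: sumr_ge0 => i _; exact: sqr_ge0.
Qed.

Lemma eball_subset_box n (x : 'rV[R]_n) (r : R) : eball x r `<=` box x r.
Proof.
move=> y /= yr i; apply: le_lt_trans yr.
by have := coord_le_enorm (y - x) i; rewrite !mxE.
Qed.

(** A sum of [n] squares below [(r / n.+1)^2] is at most [n / n.+1^2 * r^2 < r^2]. The divisor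
    [n.+1] makes this strict and is nonzero also for [n = 0]. *)
Lemma box_subset_eball n (x : 'rV[R]_n) (r : R) : 0 < r ->
  box x (r / n.+1%:R) `<=` eball x r.
Proof.
move=> r0 y yx; rewrite /eball/= enorm_lt//.
apply: (@le_lt_trans _ _ (\sum_(i < n) (r / n.+1%:R) ^+ 2)).
  apply: ler_sum => i _; rewrite !mxE -ler_sqrt ?sqr_ge0// !sqrtr_sqr.
  by rewrite [leRHS]ger0_norm ?divr_ge0 ?(ltW r0)// ltW// yx.
rewrite sumr_const card_ord -[_ *+ n]mulr_natr expr_div_n.
rewrite [ltLHS]mulrAC ltr_pdivrMr ?exprn_gt0// ltr_pM2l ?exprn_gt0// -natrX ltr_nat.
by rewrite (leq_trans (ltnSn n))// leq_pmull.
Qed.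

Lemma measurable_eball n (x : 'rV[R]_n) (r : R) : measurable (eball x r).
Proof.
pose f (y : 'rV[R]_n) : measurableTypeR R := \sum_(i < n) (y - x) ord0 i ^+ 2.
have mf : measurable_fun setT f.
  apply: measurable_sum => i.
  under eq_fun do rewrite !mxE.
  apply: measurable_funX; apply: measurable_funB => //.
  exact: measurable_rV_coord.
have [r0|r0] := leP r 0.
  rewrite (_ : eball x r = set0)//; apply/seteqP; split=> // y /=.
  by rewrite /eball/= ltNge (le_trans r0)// enorm_ge0.
rewrite (_ : eball x r = f @^-1` `]-oo, r ^+ 2[).
  by rewrite -[X in measurable X]setTI; apply: mf => //; exact: measurable_itv.
by apply/seteqP; split=> y; rewrite /eball/= in_itv/= enorm_lt.
Qed.

Local Open Scope ereal_scope.

Lemma lebesgue_eball_ge n (x : 'rV[R]_n) (r : R) : (0 < r)%R ->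
  ((2 * (r / n.+1%:R)) ^+ n)%:E <= lebesgue_rV R n (eball x r).
Proof.
move=> r0; rewrite -(lebesgue_box x) ?divr_gt0//; apply: le_measure.
- by rewrite inE; exact: measurable_box.
- by rewrite inE; exact: measurable_eball.
- exact: box_subset_eball.
Qed.

Lemma lebesgue_eball_le n (x : 'rV[R]_n) (r : R) : (0 < r)%R ->
  lebesgue_rV R n (eball x r) <= ((2 * r) ^+ n)%:E.
Proof.
move=> r0; rewrite -(lebesgue_box x)//; apply: le_measure.
- by rewrite inE; exact: measurable_eball.
- by rewrite inE; exact: measurable_box.
- exact: eball_subset_box.
Qed.

Lemma integral_eball_le n (x : 'rV[R]_n.+1) (r M : R) (g : R -> R) :
  (0 < r)%R -> (forall t, 0 <= g t)%R ->
  measurable_fun [set: measurableTypeR R] (EFin \o g) ->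
  \int[lebesgue_measure]_(t in `](x ord0 ord0 - r)%R, (x ord0 ord0 + r)%R[) (g t)%:E
    <= (2 * r * M)%:E ->
  \int[lebesgue_rV R n.+1]_(y in eball x r) (g (y ord0 ord0))%:E <=
    ((2 * r) ^+ n.+1 * M)%:E.
Proof.
move=> r0 g0 mg gM.
apply: (@le_trans _ _ (\int[lebesgue_rV R n.+1]_(y in box x r) (g (y ord0 ord0))%:E)).
  apply: ge0_subset_integral.
  - exact: measurable_eball.
  - exact: measurable_box.
  - exact: (measurable_fun_ord0 mg).
  - by move=> y _; rewrite lee_fin.
  - exact: eball_subset_box.
rewrite box_slab (@integral_slab _ _ _ _ (EFin \o g))//; last exact: measurable_box.
rewrite lebesgue_box// (_ : (_ * M)%:E = (2 * r * M)%:E * ((2 * r) ^+ n)%:E).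
  by apply: lee_wpmul2r => //; rewrite lee_fin exprn_ge0// mulr_ge0// ltW.
by rewrite -EFinM exprS; congr EFin; ring.
Qed.

(** The integral is bounded on the circumscribed cube and the volume from below by the inscribed
    one; their sides have ratio [n.+2], whence the factor [n.+2 ^ n.+1]. *)
Lemma average_eball_le n (x : 'rV[R]_n.+1) (r M : R) (g : R -> R) :
  (0 < r)%R -> (0 <= M)%R -> (forall t, 0 <= g t)%R ->
  measurable_fun [set: measurableTypeR R] (EFin \o g) ->
  \int[lebesgue_measure]_(t in `](x ord0 ord0 - r)%R, (x ord0 ord0 + r)%R[) (g t)%:E
    <= (2 * r * M)%:E ->
  average (eball x r) (fun y => g (y ord0 ord0)) <= (n.+2%:R ^+ n.+1 * M)%:E.
Proof.
move=> r0 M0 g0 mg gM; rewrite /average.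
have hl := lebesgue_eball_ge x r0; have hu := lebesgue_eball_le x r0.
have hi := integral_eball_le r0 g0 mg gM.
have i0 : 0 <= \int[lebesgue_rV R n.+1]_(y in eball x r) (g (y ord0 ord0))%:E.
  by apply: integral_ge0 => y _; rewrite lee_fin.
have v0 : (0 < (2 * (r / n.+2%:R)) ^+ n.+1)%R.
  by rewrite exprn_gt0// mulr_gt0// divr_gt0.
(* The bounds rule out infinite values, which leaves an inequality between reals. *)
move: hl hu hi i0; case: (lebesgue_rV R n.+1 (eball x r)) => [l||]//.
case: (\int[_]_(_ in _) _) => [i||]//.
rewrite !lee_fin => hl hu hi i0.
have l0 : (0 < l)%R by exact: lt_le_trans hl.
rewrite inver gt_eqF// -EFinM lee_fin ler_pdivrMr//.
apply: (le_trans hi); rewrite mulrAC ler_wpM2r//.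
apply: (@le_trans _ _ (n.+2%:R ^+ n.+1 * (2 * (r / n.+2%:R)) ^+ n.+1)%R); last first.
  by rewrite ler_wpM2l// exprn_ge0.
rewrite -exprMn (_ : n.+2%:R * (2 * (r / n.+2%:R)) = 2 * r)%R//.
by rewrite mulrCA [(_ * (r / _))%R]mulrC divfK.
Qed.

End balls.

(** * Mass of balls, doubling, and the two positive conditions *)

Section power_weight_balls.
Context {R : realType}.
Variables (n : nat) (alpha : R).
Hypothesis alpha0 : 0 <= alpha.
Local Open Scope ereal_scope.
Notation om := (@power_measure R n alpha).

Lemma power_measure_eball_le (x : 'rV[R]_n.+1) (r : R) : (0 < r)%R ->
  om (eball x r) <= ((2 * r) ^+ n.+1 * (`|x ord0 ord0| + r) `^ alpha)%:E.
Proof.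
move=> r0; apply: (@integral_eball_le _ _ _ _ _ (fun t => `|t| `^ alpha)%R) => //.
- exact: measurable_norm_powR.
- exact: integral_norm_powR_ge0.
Qed.

Lemma power_measure_slab_ge (I : set (measurableTypeR R)) (c : 'rV[R]_n) (r m : R) :
  (0 < r)%R -> measurable I -> (0 <= m)%R -> (forall t, I t -> m <= `|t|)%R ->
  (m `^ alpha)%:E * (lebesgue_measure I * ((2 * r) ^+ n)%:E) <= om (slab I (box c r)).
Proof.
move=> r0 mI m0 mle; rewrite -(lebesgue_box c r0) -lebesgue_slab//;
  last exact: measurable_box.
have mS := measurable_slab mI (measurable_box c r).
apply: (@integral_ge_cst _ _ _ (lebesgue_rV R n.+1)) => //.
- by rewrite powR_ge0.
- by move=> x _; rewrite lee_fin powR_ge0.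
- move=> x [/= /mle h _]; rewrite lee_fin; exact: ge0_ler_powR.
Qed.

(** Here [s] is the half-side of the inscribed cube. The weight may vanish inside that cube, so only
    a part of it is kept, on which the weight is at least of the order found in the upper bound. *)
Lemma power_measure_eball_ge (x : 'rV[R]_n.+1) (r : R) (s := (r / n.+2%:R)%R) :
  (0 < r)%R ->
  ((`|x ord0 ord0| + s / 2) `^ alpha * (s / 2 * (2 * s) ^+ n))%:E <= om (eball x r).
Proof.
move=> r0; have s0 : (0 < s)%R by rewrite divr_gt0.
set a := x ord0 ord0.
(* The outer half of ]a, a + s[ or of ]a - s, a[, on the side away from 0. *)
suff [I [mI IE Iin Ige]] : exists I : set (measurableTypeR R),
    [/\ measurable I, lebesgue_measure I = (s / 2)%:E,
    I `<=` `](a - s)%R, (a + s)%R[ & forall t, I t -> (`|a| + s / 2 <= `|t|)%R].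
  have m0 : (0 <= `|a| + s / 2)%R by rewrite addr_ge0// divr_ge0// ltW.
  have := power_measure_slab_ge (@rsubmx R 1 1 n x) s0 mI m0 Ige.
  rewrite IE => h; apply: (le_trans h); apply: le_measure.
  - by rewrite inE; apply: measurable_slab => //; exact: measurable_box.
  - by rewrite inE; exact: measurable_eball.
  - apply: (subset_trans _ (box_subset_eball r0)).
    by rewrite box_slab => y [/= /Iin ? ?]; split.
have [a0|a0] := leP 0%R a.
- exists `](a + s / 2)%R, (a + s)%R[%classic; split => //.
  + by rewrite lebesgue_measure_itvoo; [congr EFin; lra|lra].
  + by move=> t /=; rewrite !in_itv/= => /andP[]; lra.
  + by move=> t /=; rewrite !in_itv/= => /andP[h _]; rewrite !ger0_norm//; lra.
- exists `](a - s)%R, (a - s / 2)%R[%classic; split => //.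
  + by rewrite lebesgue_measure_itvoo; [congr EFin; lra|lra].
  + by move=> t /=; rewrite !in_itv/= => /andP[]; lra.
  + by move=> t /=; rewrite !in_itv/= => /andP[_ h]; rewrite !ltr0_norm//; lra.
Qed.

Lemma power_measure_eball_gt0 (x : 'rV[R]_n.+1) (r : R) : (0 < r)%R ->
  0 < om (eball x r).
Proof.
move=> r0; apply: lt_le_trans (power_measure_eball_ge x r0).
have s0 : (0 < r / n.+2%:R)%R by rewrite divr_gt0.
rewrite lte_fin mulr_gt0//; first by rewrite powR_gt0// ltr_wpDl// divr_gt0.
by rewrite mulr_gt0 ?exprn_gt0 ?mulr_gt0.
Qed.

Lemma power_measure_eball_fin_num (x : 'rV[R]_n.+1) (r : R) : (0 < r)%R ->
  om (eball x r) \is a fin_num.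
Proof.
move=> r0; rewrite ge0_fin_numE ?ltW ?power_measure_eball_gt0//.
by apply: le_lt_trans (power_measure_eball_le x r0) _; rewrite ltry.
Qed.

(** The upper bound at radius [2 * r] and the lower bound at radius [r] are both of order
    [r ^ n.+1 * (|x_1| + r) ^ alpha]; the constant is their ratio. *)
Lemma power_measure_doubling (x : 'rV[R]_n.+1) (r : R) : (0 < r)%R ->
  om (eball x (2 * r)) <=
    (8 * n.+2%:R * (2 * n.+2%:R) ^+ n * (4 * n.+2%:R) `^ alpha)%:E * om (eball x r).
Proof.
move=> r0; have r20 : (0 < 2 * r)%R by rewrite mulr_gt0.
apply: (le_trans (power_measure_eball_le x r20)).
apply: (le_trans _ (lee_wpmul2l _ (power_measure_eball_ge x r0))); last first.
  by rewrite lee_fin !mulr_ge0 ?exprn_ge0 ?powR_ge0 ?mulr_ge0.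
set s := (r / _)%R; set a := x ord0 ord0; set N := n.+2%:R.
have N0 : (0 < N)%R by rewrite /N.
have N1 : (1 <= N)%R by rewrite /N ler1n.
have s0 : (0 < s)%R by rewrite divr_gt0.
have rE : (r = N * s)%R by rewrite /s mulrCA divff ?mulr1// gt_eqF.
(* Since [r = N * s], the term [2 * r] equals [4 * N * (s / 2)], and [|a| <= 4 * N * |a|]. *)
have h : ((`|a| + 2 * r) `^ alpha <= (4 * N) `^ alpha * (`|a| + s / 2) `^ alpha)%R.
  rewrite -powRM; last 2 first.
  - by rewrite mulr_ge0// ltW.
  - by rewrite addr_ge0// divr_ge0// ltW.
  apply: ge0_ler_powR => //; rewrite ?nnegrE; first by rewrite addr_ge0// ltW.
    by rewrite mulr_ge0// ?addr_ge0 ?mulr_ge0 ?divr_ge0// ltW.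
  rewrite rE mulrDr lerD//; last by lra.
  by rewrite ler_peMl//; lra.
rewrite -EFinM lee_fin.
apply: (@le_trans _ _ ((2 * (2 * r)) ^+ n.+1 *
  ((4 * N) `^ alpha * (`|a| + s / 2) `^ alpha))%R).
  by rewrite ler_wpM2l// exprn_ge0// mulr_ge0// ltW.
rewrite le_eqVlt; apply/orP; left; apply/eqP.
have -> : ((2 * (2 * r)) ^+ n.+1 = (8 * N) * (2 * N) ^+ n * (s / 2 * (2 * s) ^+ n))%R.
  rewrite exprS rE.
  have -> : (2 * (2 * (N * s)) = (2 * N) * (2 * s))%R by ring.
  by rewrite [((2 * N * (2 * s)) ^+ n)%R]exprMn; field.
by ring.
Qed.

(** The quotient cancels because the mass of the ball is positive and finite. *)
Lemma Phi_power_measure (x : 'rV[R]_n.+1) (r : R) : (0 < r)%R ->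
  Phi om om x r = (r ^+ 2)%:E.
Proof.
move=> r0; change ((r ^+ 2)%:E * om (eball x r) / om (eball x r) = (r ^+ 2)%:E).
have := power_measure_eball_gt0 x r0; have := power_measure_eball_fin_num x r0.
move=> /fineK <-; set m := fine _; rewrite lte_fin => m0.
by rewrite inver gt_eqF// -!EFinM mulfK// gt_eqF.
Qed.

Lemma power_measure_scale_decay : scale_decay om om 2.
Proof.
(* With [Phi] equal to the squared radius, the condition is an equality for the constant 1. *)
exists 1%R => x r s /andP[r0 rs]; have s0 := lt_trans r0 rs.
rewrite !Phi_power_measure// mul1r powR_mulrn; last by rewrite divr_ge0// ltW.
by rewrite -EFinM -exprMn divfK// gt_eqF.
Qed.

Lemma power_measure_controlled_enlargement : controlled_enlargement om om.
Proof.
(* The doubling constant serves as [CM]; the term [om / r ^ 2] is nonnegative and is dropped. *)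
eexists => x r r0; apply: (le_trans (power_measure_doubling x r0)).
apply: lee_wpmul2l; first by rewrite lee_fin !mulr_ge0 ?exprn_ge0 ?powR_ge0 ?mulr_ge0.
by rewrite leeDl// mule_ge0// inve_ge0 lee_fin sqr_ge0.
Qed.

End power_weight_balls.

(** * The Muckenhoupt condition for the power weight *)

Section muckenhoupt_power_weight.
Context {R : realType}.
Local Open Scope ereal_scope.

Lemma power_weight_gt0_ae (n : nat) (alpha : R) :
  {ae lebesgue_rV R n.+1, forall x, (0 < power_weight alpha x)%R}.
Proof.
exists (slab [set 0%R] setT); split.
- by apply: measurable_slab => //; exact: measurable_set1.
- exact: lebesgue_hyperplane.
- move=> x /= h; split => //=; apply: contrapT => /eqP x0; apply: h.
  by rewrite powR_gt0// normr_gt0.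
Qed.

Lemma power_weight_muckenhoupt (n : nat) (p alpha : R) :
  (0 < alpha)%R -> (alpha < p - 1)%R -> muckenhoupt p (@power_weight R n alpha).
Proof.
move=> alpha0 alphap; have p0 : (0 < p - 1)%R by exact: lt_trans alphap.
split.
- exact: measurable_power_weight.
- by move=> x; exact: powR_ge0.
- exact: power_weight_gt0_ae.
(* The radius has no sign here, so integrability is proved on a larger ball of positive radius. *)
- move=> x r; have m0 : (0 < Num.max r 1)%R by rewrite lt_max ltr01 orbT.
  have mw : measurable_fun setT (EFin \o @power_weight R n alpha).
    by apply/measurable_EFinP; exact: measurable_power_weight.
  apply: (@integrableS _ _ _ _ (eball x (Num.max r 1)%R)).
  + exact: measurable_eball.
  + exact: measurable_eball.
  + by move=> y; rewrite /eball/= => /lt_le_trans; apply; rewrite le_max lexx.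
  apply/integrableP; split; first exact: measurable_funTS.
  rewrite (eq_integral (EFin \o @power_weight R n alpha)); last first.
    by move=> y _; rewrite /= ger0_norm// powR_ge0.
  rewrite -ge0_fin_numE; last first.
    by apply: integral_ge0 => y _; rewrite lee_fin powR_ge0.
  exact: (power_measure_eball_fin_num (ltW alpha0) x m0).
(* The dual weight is [|x_1|] to the power [- b], and [alpha < p - 1] says exactly that [b < 1]. *)
pose b := (alpha / (p - 1))%R.
have b01 : (0 < b < 1)%R by rewrite /b divr_gt0//= ltr_pdivrMr// mul1r.
have [b0 b1] := andP b01.
pose K1 : R := (n.+2%:R ^+ n.+1)%R.
exists (K1 * (K1 * (3 / (1 - b))) `^ (p - 1))%R => x r r0.
set a : R := `|x ord0 ord0|%R.
have c0 : (0 < a + r)%R by rewrite ltr_wpDl// normr_ge0.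
have K10 : (0 <= K1)%R by rewrite exprn_ge0.
have q0 : (0 <= 3 / (1 - b))%R by rewrite divr_ge0// subr_ge0 ltW.
have A1 : average (eball x r) (power_weight alpha) <= (K1 * (a + r) `^ alpha)%:E.
  apply: (@average_eball_le _ _ _ _ _ (fun t => `|t| `^ alpha)%R) => //.
  - by rewrite powR_ge0.
  - exact: measurable_norm_powR.
  - exact: (integral_norm_powR_ge0 _ (ltW alpha0)).
have A2 : average (eball x r) (fun y => power_weight alpha y `^ (- (p - 1)^-1))%R
    <= (K1 * (3 / (1 - b) * (a + r) `^ (- b)))%:E.
  have -> : (fun y : 'rV[R]_n.+1 => power_weight alpha y `^ (- (p - 1)^-1))%R =
      (fun y => `|y ord0 ord0| `^ (- b))%R.
    by apply/funext => y; rewrite /power_weight -powRrM mulrN.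
  apply: (@average_eball_le _ _ _ _ _ (fun t => `|t| `^ (- b))%R) => //.
  - by rewrite mulr_ge0 ?powR_ge0.
  - exact: measurable_norm_powR.
  - exact: integral_norm_powR_lt0.
have av0 f : (forall y, 0 <= f y)%R -> 0 <= average (eball x r) f.
  move=> f0; rewrite mule_ge0 ?inve_ge0// integral_ge0// => y _.
  by rewrite lee_fin.
have A3 :
  average (eball x r) (fun y => power_weight alpha y `^ (- (p - 1)^-1))%R `^ (p - 1) <=
    ((K1 * (3 / (1 - b))) `^ (p - 1) * (a + r) `^ (- alpha))%:E.
  apply: (@le_trans _ _ ((K1 * (3 / (1 - b) * (a + r) `^ (- b)))%:E `^ (p - 1))).
    apply: gt0_ler_poweR => //; first exact: ltW.
      by rewrite in_itv/= leey andbT av0// => y; exact: powR_ge0.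
    by rewrite in_itv/= leey andbT lee_fin mulr_ge0// mulr_ge0// powR_ge0.
  rewrite poweR_EFin lee_fin mulrA powRM ?powR_ge0//; last exact: mulr_ge0.
  (* As [b * (p - 1) = alpha], this factor is [(a + r) ^ (- alpha)], which cancels the power in [A1]
     and leaves a bound independent of the ball. *)
  rewrite -powRrM; by rewrite mulNr /b divfK// gt_eqF.
apply: (le_trans (lee_pmul _ _ A1 A3)).
- by apply: av0 => y; exact: powR_ge0.
- exact: poweR_ge0.
rewrite -EFinM lee_fin powRN le_eqVlt; apply/orP; left; apply/eqP.
by field; rewrite gt_eqF// powR_gt0.
Qed.

End muckenhoupt_power_weight.

(** * Functions of the first coordinate and the ramp *)

Section coordinate_functions.
Context {R : realType}.

Lemma coord_le_norm m (x : 'rV[R]_m.+1) : `|x ord0 ord0| <= `|x|.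
Proof.
rewrite /Num.norm/= mx_normrE.
exact: (le_bigmax _ (fun ij : 'I_1 * 'I_m.+1 => `|x ij.1 ij.2|) (ord0, ord0)).
Qed.

(** Where [g] is affine near [x_1], all difference quotients are eventually constant: [l] along the
    first axis, and 0 along the others, which do not move [x_1]. *)
Lemma enorm_gradient_ord0 n (g : R -> R) (x : 'rV[R]_n.+1) (l : R) :
  (\forall h \near (0 : R), g (h + x ord0 ord0) = g (x ord0 ord0) + h * l) ->
  enorm (gradient (fun y => g (y ord0 ord0)) x) ^+ 2 = l ^+ 2.
Proof.
move=> gl.
have D (i : 'I_n.+1) :
    'D_(delta_mx ord0 i) (fun y : 'rV[R]_n.+1 => g (y ord0 ord0)) x =
    (i == ord0)%:R * l.
  rewrite /derive; apply: lim_near_cst; first exact: norm_hausdorff.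
  rewrite /dnbhs near_withinE; apply: filterS gl => h gh h0.
  rewrite /= !mxE eqxx eq_sym /=.
  case: (i == ord0) => /=.
    by rewrite mulr1 mul1r gh addrC addKr [_ *: _]mulKf.
  by rewrite mulr0 add0r subrr scaler0 mul0r.
rewrite sqr_sqrtr; last by apply: sumr_ge0 => i _; exact: sqr_ge0.
rewrite big_ord_recl big1 => [|i _]; rewrite mxE D ?eqxx ?mul1r ?addr0//.
by rewrite eq_sym (negbTE (neq_lift _ _)) mul0r expr0n.
Qed.

Definition ramp (e t : R) : R := Num.max 0 (Num.min 1 (t / e)).

Lemma ramp_le0 e t : 0 < e -> t <= 0 -> ramp e t = 0.
Proof.
move=> e0 t0; have h : t / e <= 0 by rewrite pmulr_lle0 ?invr_gt0.
by rewrite /ramp; case: (leP 1 (t / e)) => h1; case: leP => h2; lra.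
Qed.

Lemma ramp_ge e t : 0 < e -> e <= t -> ramp e t = 1.
Proof.
move=> e0 te; have h : 1 <= t / e by rewrite ler_pdivlMr// mul1r.
by rewrite /ramp; case: (leP 1 (t / e)) => h1; case: leP => h2; lra.
Qed.

Lemma ramp_itv e t : 0 < e -> 0 <= t <= e -> ramp e t = t / e.
Proof.
move=> e0 /andP[t0 te]; have h : t / e <= 1 by rewrite ler_pdivrMr// mul1r.
have h' : 0 <= t / e by rewrite divr_ge0// ltW.
by rewrite /ramp; case: (leP 1 (t / e)) => h1; case: leP => h2; lra.
Qed.

(** Clamping to the unit interval is 1-Lipschitz, and is applied here to [s / e] and [t / e]. *)
Lemma ramp_lipschitz e s t : 0 < e -> `|ramp e s - ramp e t| <= e^-1 * `|s - t|.
Proof.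
move=> e0; have -> : e^-1 * `|s - t| = `|s / e - t / e|.
  by rewrite -mulrBl normrM [`|e^-1|]gtr0_norm ?invr_gt0// mulrC.
rewrite /ramp; move: (s / e) (t / e) => a b; rewrite ler_norml.
have := ler_norm (a - b); have := ler_norm (- (a - b)); rewrite normrN.
set c : R := `|a - b| => c1 c2; apply/andP.
by split; case: (leP 0 (Num.min 1 a)); case: (leP 0 (Num.min 1 b));
  case: (leP 1 a) => ?; case: (leP 1 b) => ? ? ?; lra.
Qed.

(** Away from its two corners 0 and [e], the ramp is locally affine. *)
Lemma enorm_gradient_ramp n e (x : 'rV[R]_n.+1) : 0 < e ->
  x ord0 ord0 != 0 -> x ord0 ord0 != e ->
  enorm (gradient (fun y => ramp e (y ord0 ord0)) x) ^+ 2 =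
  if 0 < x ord0 ord0 < e then e ^- 2 else 0.
Proof.
set t := x ord0 ord0 => e0 t0 te.
have [tn|tp|tt] := ltgtP t 0; last by rewrite tt eqxx in t0.
  rewrite (@enorm_gradient_ord0 _ _ _ 0) ?expr0n//=.
  have : \forall h \near (0 : R), h < - t by apply: lt_nbhsl; rewrite oppr_gt0.
  by apply: filterS => h ht; rewrite !ramp_le0 ?mulr0 ?addr0// -/t; lra.
have [tl|tg|tt] := ltgtP t e; last by rewrite tt eqxx in te.
  rewrite (@enorm_gradient_ord0 _ _ _ e^-1) ?exprVn//=.
  have h1 : \forall h \near (0 : R), h < e - t by apply: lt_nbhsl; rewrite subr_gt0.
  have h2 : \forall h \near (0 : R), - t < h by apply: lt_nbhsr; rewrite oppr_lt0.
  apply: filterS2 h1 h2 => h h1 h2; rewrite -/t !ramp_itv//; last 2 first.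
  - by rewrite !ltW.
  - by apply/andP; split; lra.
  by rewrite mulrDl addrC.
rewrite (@enorm_gradient_ord0 _ _ _ 0) ?expr0n//=.
have : \forall h \near (0 : R), e - t < h by apply: lt_nbhsr; rewrite subr_lt0.
by apply: filterS => h ht; rewrite !ramp_ge ?mulr0 ?addr0// -/t; lra.
Qed.

Lemma ramp_locally_lipschitz n e
    (u : 'rV[R]_n.+1 -> R := fun x => ramp e (x ord0 ord0)) :
  0 < e -> [locally [lipschitz u x | x in setT]].
Proof.
move=> e0; apply: lipschitz_locally; apply: (@klipschitzW _ _ _ e^-1).
  exact: (@globally_properfilter _ _ (0, 0)).
move=> [x y] _ /=; apply: (le_trans (ramp_lipschitz _ _ e0)).
rewrite ler_wpM2l ?invr_ge0 ?(ltW e0)//.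
by have := coord_le_norm (x - y); rewrite !mxE.
Qed.

End coordinate_functions.

Lemma ex_powR_lt {R : realType} (K m b : R) : 0 <= K -> 0 < m -> 0 < b ->
  exists2 e : R, 0 < e <= 2^-1 & K * e `^ b < m.
Proof.
move=> K0 m0 b0; have K1 : 0 < K + 1 by lra.
have q0 : 0 < m / (K + 1) by rewrite divr_gt0.
move qE : (m / (K + 1)) q0 => q q0.
have qb : q = (q `^ b^-1) `^ b by rewrite -powRrM mulVf ?gt_eqF// powRr1// ltW.
(* The second entry solves [e ^ b = m / (K + 1)]; the [+ 1] allows [K = 0] and makes the final
   inequality strict. The cap [2^-1] later keeps the transition of the ramp short of the test cube
   at [x_1 > 2^-1]. *)
exists (Num.min 2^-1 (q `^ b^-1)).
  by rewrite lt_min powR_gt0// invr_gt0 ltr0n/= ge_min lexx.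
set e := Num.min _ _.
have h : e `^ b <= q.
  rewrite qb; apply: ge0_ler_powR; rewrite ?nnegrE ?powR_ge0 ?(ltW b0)//.
    by rewrite le_min powR_ge0 invr_ge0 ler0n.
  by rewrite ge_min lexx orbT.
have {}h : K * e `^ b <= K * q by rewrite ler_wpM2l.
apply: (le_lt_trans h); rewrite -qE mulrA ltr_pdivrMr// mulrC ltr_pM2l//; lra.
Qed.

(** * Vanishing energy of the ramps and failure of the Poincaré inequality *)

Section poincare_failure.
Context {R : realType}.
Variables (n : nat) (alpha : R).
Hypothesis alpha1 : 1 < alpha.
Local Open Scope ereal_scope.
Let alpha0 : (0 <= alpha)%R. Proof. exact: (le_trans ler01 (ltW alpha1)). Qed.
Notation om := (@power_measure R n alpha).

Lemma power_measure_hyperplane (c : R) : om (slab [set c] setT) = 0.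
Proof.
apply: null_set_integral.
- by apply: measurable_slab => //; exact: measurable_set1.
- apply: measurable_funTS; apply/measurable_EFinP; exact: measurable_power_weight.
- exact: lebesgue_hyperplane.
Qed.

Lemma power_measure_slab_le (e s : R) (z : 'rV[R]_n) : (0 < e)%R -> (0 < s)%R ->
  om (slab `]0%R, e[ (box z s)) <= (e `^ alpha * e * (2 * s) ^+ n)%:E.
Proof.
move=> e0 s0.
rewrite [leLHS](integral_slab (g := fun t => (`|t| `^ alpha)%:E))//; last 2 first.
- exact: measurable_box.
- exact: measurable_norm_powR.
rewrite lebesgue_box// EFinM; apply: lee_wpmul2r.
  by rewrite lee_fin exprn_ge0// mulr_ge0// ltW.
have -> : (e `^ alpha * e)%:E = (e `^ alpha)%:E * lebesgue_measure `]0%R, e[.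
  by rewrite lebesgue_measure_itvoo ?subr0// ltW.
apply: integral_le_cst => //; first exact: measurable_norm_powR.
move=> t /=; rewrite in_itv/= => /andP[t0 te]; rewrite powR_ge0/=.
by apply: ge0_ler_powR; rewrite ?nnegrE ?(ltW e0)// gtr0_norm ?ltW.
Qed.

Lemma integral_gradient_ramp_le (e s : R) (z : 'rV[R]_n.+1) : (0 < e)%R -> (0 < s)%R ->
  \int[om]_(x in eball z s)
    (enorm (gradient (fun y : 'rV[R]_n.+1 => ramp e (y ord0 ord0)) x) ^+ 2)%:E
  <= (e `^ (alpha - 1) * (2 * s) ^+ n)%:E.
Proof.
move=> e0 s0.
pose N : set 'rV[R]_n.+1 := slab [set 0%R] setT `|` slab [set e] setT.
pose S : set 'rV[R]_n.+1 := slab `]0%R, e[ setT.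
have mN : measurable N.
  by apply: measurableU; apply: measurable_slab => //; exact: measurable_set1.
have mS : measurable S by exact: measurable_slab.
have N0 : om N = 0.
  apply/eqP; rewrite eq_le measure_ge0 andbT.
  apply: (le_trans (measureU2 _ _ _)) => //.
  - by apply: measurable_slab => //; exact: measurable_set1.
  - by apply: measurable_slab => //; exact: measurable_set1.
  - have h c : om (slab [set c] setT) <= 0 by rewrite power_measure_hyperplane.
    by rewrite -[leRHS]adde0; apply: leeD; exact: h.
have mB := measurable_eball z s.
have mi (A : set 'rV[R]_n.+1) : measurable A ->
    measurable_fun (eball z s) (fun x => (\1_A x : R)%:E).
  by move=> mA; apply/measurable_EFinP; exact: measurable_indic.
(* The gradient has arbitrary values on the two hyperplanes of N. *)
apply: (@le_trans _ _ (\int[om]_(x in eball z s)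
    ((e ^- 2)%:E * (\1_S x)%:E + +oo * (\1_N x)%:E))).
  apply: ge0_le_integral_nomeas => x _; first by rewrite lee_fin sqr_ge0.
  have [xN|xN] := boolP (x \in N).
    by rewrite [\1_N x]indicE xN mule1 addey ?leey// -EFinM ltNye.
  rewrite [\1_N x]indicE (negbTE xN) mule0 adde0 -EFinM lee_fin.
  move/negP: xN; rewrite inE => xN.
  rewrite enorm_gradient_ramp//; last 2 first.
  - by apply/eqP => x0; apply: xN; left; split.
  - by apply/eqP => x0; apply: xN; right; split.
  case: ifPn => xe; last by rewrite mulr_ge0// invr_ge0 sqr_ge0.
  by rewrite indicE mem_set ?mulr1//; split => //=; rewrite in_itv.
rewrite ge0_integralD//; last 3 first.
- by move=> x _; rewrite -EFinM lee_fin mulr_ge0// invr_ge0 sqr_ge0.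
- by apply: measurable_funeM; exact: mi.
- by apply: measurable_funeM; exact: mi.
rewrite ge0_integralZl//; last 2 first.
- exact: mi.
- by rewrite lee_fin invr_ge0 sqr_ge0.
rewrite ge0_integralZl//; last exact: mi.
have NB0 : om (N `&` eball z s) = 0.
  apply/eqP; rewrite eq_le measure_ge0 andbT -[leRHS]N0; apply: le_measure.
  - by rewrite inE; exact: measurableI.
  - by rewrite inE.
  - exact: subIsetl.
rewrite !integral_indic//.
change ((e ^- 2)%:E * om (S `&` eball z s) + +oo * om (N `&` eball z s)
  <= (e `^ (alpha - 1) * (2 * s) ^+ n)%:E).
(* The convention [+oo * 0 = 0] removes the contribution of the null set [N]. *)
rewrite NB0 mule0 adde0.
apply: (@le_trans _ _ ((e ^- 2)%:E * (e `^ alpha * e * (2 * s) ^+ n)%:E)).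
  apply: lee_wpmul2l; first by rewrite lee_fin invr_ge0 sqr_ge0.
  apply: le_trans (power_measure_slab_le (@rsubmx R 1 1 n z) e0 s0).
  apply: le_measure.
  - by rewrite inE; exact: measurableI.
  - by rewrite inE; apply: measurable_slab => //; exact: measurable_box.
  (* The slab [S] is unbounded; the ball confines the remaining coordinates to a cube of side
     [2 * s]. *)
  - move=> x [[x1 _] /eball_subset_box]; rewrite box_slab => -[_ x2].
    by split.
rewrite -EFinM lee_fin le_eqVlt; apply/orP; left; apply/eqP.
rewrite powRB; last by rewrite gt_eqF// implybT.
by rewrite powRr1 ?ltW//; field; rewrite gt_eqF.
Qed.

Lemma power_measure_half_box_gt0 (I : set (measurableTypeR R)) :
  measurable I -> lebesgue_measure I = (2^-1)%:E -> (forall t, I t -> 2^-1 <= `|t|)%R ->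
  (2^-1 `^ alpha * (2^-1 * (2 * 1) ^+ n))%:E <= om (slab I (box 0 1)).
Proof.
move=> mI IE Ige.
have h0 : (0 <= 2^-1 :> R)%R by rewrite invr_ge0.
by have := power_measure_slab_ge alpha0 (0 : 'rV[R]_n)%R ltr01 mI h0 Ige; rewrite IE.
Qed.

Lemma power_measure_not_mixed_poincare : ~ mixed_poincare om om.
Proof.
move=> [C [Lambda [Lambda1 H]]].
(* In dimension [n.+1] this radius makes the inscribed cube of [box_subset_eball] have half-side
   1. *)
pose r : R := n.+2%:R; pose z : 'rV[R]_n.+1 := 0%R.
have r0 : (0 < r)%R by [].
have s0 : (0 < Lambda * r)%R by rewrite mulr_gt0//; lra.
pose I1 : set (measurableTypeR R) := `](-1)%R, (- 2^-1)%R[%classic.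
pose I2 : set (measurableTypeR R) := `]2^-1%R, 1%R[%classic.
pose m : R := (2^-1 `^ alpha * (2^-1 * (2 * 1) ^+ n))%R.
have m0 : (0 < m)%R by rewrite mulr_gt0 ?powR_gt0 ?mulr_gt0 ?exprn_gt0 ?invr_gt0.
have mI1 : measurable I1 by exact: measurable_itv.
have E1 : m%:E <= om (slab I1 (box 0 1)).
  apply: power_measure_half_box_gt0 => //.
    by rewrite lebesgue_measure_itvoo; [congr EFin; lra|lra].
  by move=> t; rewrite /I1/= in_itv/= => /andP[_ t0]; rewrite ltr0_norm; lra.
have mI2 : measurable I2 by exact: measurable_itv.
have E2 : m%:E <= om (slab I2 (box 0 1)).
  apply: power_measure_half_box_gt0 => //.
    by rewrite lebesgue_measure_itvoo; [congr EFin; lra|lra].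
  by move=> t; rewrite /I2/= in_itv/= => /andP[t0 _]; rewrite gtr0_norm; lra.
have mE (I : set (measurableTypeR R)) :
    measurable I -> measurable (slab I (box (0 : 'rV[R]_n) 1)).
  by move=> mI; apply: measurable_slab => //; exact: measurable_box.
have sub (I : set (measurableTypeR R)) : I `<=` `](- 1)%R, 1%R[ ->
    slab I (box (0 : 'rV[R]_n) 1) `<=` eball z r.
  move=> Isub; have := @box_subset_eball R n.+1 z _ r0; rewrite divff ?pnatr_eq0//.
  apply: subset_trans; rewrite box_slab => y [/= y1 y2]; split => /=.
    by rewrite mxE sub0r add0r; exact: Isub.
  by move=> i; have := y2 i; rewrite !mxE.
have s1 : I1 `<=` `](- 1)%R, 1%R[ by move=> t; rewrite /I1 /I2 /= !in_itv/=; lra.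
have s2 : I2 `<=` `](- 1)%R, 1%R[ by move=> t; rewrite /I1 /I2 /= !in_itv/=; lra.
pose M : R := fine (om (eball z r)).
have MM : om (eball z r) = M%:E by rewrite fineK// (power_measure_eball_fin_num _ _ r0).
have M0 : (0 <= M)%R by rewrite fine_ge0.
(* [K * e ^ (alpha - 1)] will dominate the right-hand side, with [K] independent of [e]. The
   absolute value is taken because the sign of [C] is unknown. *)
pose K : R := (`|C| * r ^+ 2 * M * (2 * (Lambda * r)) ^+ n)%R.
have K0 : (0 <= K)%R by rewrite !mulr_ge0 ?exprn_ge0 ?mulr_ge0//; lra.
have mm0 : (0 < m * m)%R by rewrite mulr_gt0.
have b0 : (0 < alpha - 1)%R by rewrite subr_gt0.
have [e /andP[e0 e2] Ke] := ex_powR_lt K0 mm0 b0.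
pose u (y : 'rV[R]_n.+1) := ramp e (y ord0 ord0).
have := H z r u r0 (@ramp_locally_lipschitz R n e e0); apply/negP; rewrite -ltNge.
have G := integral_gradient_ramp_le z e0 s0.
have G0 : 0 <= \int[om]_(x in eball z (Lambda * r)) (enorm (gradient u x) ^+ 2)%:E.
  by apply: integral_ge0 => x _; rewrite lee_fin sqr_ge0.
change ((C * r ^+ 2)%:E * om (eball z r) *
   \int[om]_(x in eball z (Lambda * r)) (enorm (gradient u x) ^+ 2)%:E <
   \int[om]_(y in eball z r) \int[om]_(x in eball z r) (`|u x - u y| ^+ 2)%:E).
rewrite MM.
apply: (@le_lt_trans _ _ (K * e `^ (alpha - 1))%:E).
  apply: (@le_trans _ _ ((`|C| * r ^+ 2 * M)%:E *
     \int[om]_(x in eball z (Lambda * r)) (enorm (gradient u x) ^+ 2)%:E)).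
    apply: lee_wpmul2r => //; rewrite -EFinM lee_fin ler_wpM2r// ler_wpM2r ?sqr_ge0//.
    exact: ler_norm.
  apply: (@le_trans _ _ ((`|C| * r ^+ 2 * M)%:E *
      (e `^ (alpha - 1) * (2 * (Lambda * r)) ^+ n)%:E)).
    by apply: lee_wpmul2l => //; rewrite lee_fin mulr_ge0// mulr_ge0// sqr_ge0.
  by rewrite -EFinM lee_fin le_eqVlt; apply/orP; left; apply/eqP; rewrite /K; ring.
apply: (@lt_le_trans _ _ (m * m)%:E); first by rewrite lte_fin.
have in0 (y : 'rV[R]_n.+1) : 0 <= \int[om]_(x in eball z r) (`|u x - u y| ^+ 2)%:E.
  by apply: integral_ge0 => x _; rewrite lee_fin sqr_ge0.
(* The double integral is restricted to [y] over [I1], where [u = 0], and [x] over [I2], where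
   [u = 1] because [e <= 2^-1]. The integrand is 1 there, and each cube has mass at least [m]. *)
apply: (@le_trans _ _ (m%:E * om (slab I1 (box 0 1)))).
  by rewrite EFinM; apply: lee_wpmul2l => //; rewrite lee_fin ltW.
apply: integral_ge_cst => //.
- exact: measurable_eball.
- exact: mE.
- exact: sub.
- exact: ltW.
move=> y [/= y1 _].
have uy : u y = 0%R.
  by rewrite /u ramp_le0//; move: y1; rewrite /I1/= in_itv/= => /andP[_]; lra.
apply: (le_trans E2); rewrite -[leLHS]mul1e.
apply: integral_ge_cst => //.
- exact: measurable_eball.
- exact: mE.
- exact: sub.
move=> x [/= x1 _]; rewrite uy /u ramp_ge//; last first.
  by move: x1; rewrite /I2/= in_itv/= => /andP[h _]; lra.
by rewrite subr0 normr1 expr1n.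
Qed.

End poincare_failure.

(* R^d is 'rV[R]_n.+1 with d = n + 1. *)
Theorem proposition5p17 (R : realType) (n : nat) (p alpha : R) :
  2 < p -> 1 < alpha -> alpha < p - 1 ->
  let om : {measure set 'rV[R]_n.+1 -> \bar R} := power_measure alpha in
  let pi : {measure set 'rV[R]_n.+1 -> \bar R} := om in
  [/\ muckenhoupt p (@power_weight R n alpha),
      scale_decay om pi 2,
      controlled_enlargement om pi
    & ~ mixed_poincare om pi].
Proof.
move=> _ alpha1 alphap om pi; have alpha0 := lt_trans ltr01 alpha1.
split.
- exact: power_weight_muckenhoupt.
- exact: (power_measure_scale_decay _ (ltW alpha0)).
- exact: (power_measure_controlled_enlargement _ (ltW alpha0)).
- exact: power_measure_not_mixed_poincare.
Qed.
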